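(* Let $\mathcal{F}$, $\tilde{\mathcal{F}}$ and $\mathcal{G}$ be nontrivial subspaces of a real or complex Hilbert space $\mathcal{H}$. Then $$\mathrm{dist}\big(\cos^2(\hat{\Theta}(\mathcal{F},\mathcal{G})),\ \cos^2(\hat{\Theta}(\tilde{\mathcal{F}},\mathcal{G}))\big)\le\mathrm{gap}(\mathcal{F},\tilde{\mathcal{F}}).$$
   Context: A subspace means a closed linear manifold; nontrivial means different from $\{0\}$. $P_{\mathcal{F}}$ denotes the orthogonal projector onto $\mathcal{F}$; $\Sigma$ denotes the spectrum; $(P_{\mathcal{F}}P_{\mathcal{G}})|_{\mathcal{F}}$ is regarded as an operator $\mathcal{F}\to\mathcal{F}$. The set of angles from $\mathcal{F}$ to $\mathcal{G}$ is $$\hat{\Theta}(\mathcal{F},\mathcal{G})=\{\theta:\theta=\arccos(\sigma),\ \sigma\ge 0,\ \sigma^2\in\Sigma((P_{\mathcal{F}}P_{\mathcal{G}})|_{\mathcal{F}})\}\subseteq[0,\pi/2].$$ A function applied to a set denotes the image of the set. For bounded real sets $S_1,S_2$, $\mathrm{dist}(S_1,S_2)=\max\{\sup_{u\in S_1}\mathrm{dist}(u,S_2),\sup_{v\in S_2}\mathrm{dist}(v,S_1)\}$ is the Hausdorff distance, where $\mathrm{dist}(u,S)=\inf_{v\in S}|u-v|$. The gap is $\mathrm{gap}(\mathcal{F},\tilde{\mathcal{F}})=\|P_{\mathcal{F}}-P_{\tilde{\mathcal{F}}}\|$ (operator norm). *)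

(* Defs.v *)
From HB Require Import structures.
From mathcomp Require Import all_boot all_order all_algebra.
From mathcomp Require Import all_classical all_reals all_analysis.
From mathcomp Require Import complex.

Set Implicit Arguments.
Unset Strict Implicit.
Unset Printing Implicit Defensive.
Import Order.TTheory GRing.Theory Num.Theory.
Import numFieldNormedType.Exports.

Local Open Scope classical_set_scope.
Local Open Scope ring_scope.

Variant scalar_kind := RealScalars | ComplexScalars.

Section scalars.
Variable R : realType.

Definition scalar_field (k : scalar_kind) : numFieldType :=
  match k with RealScalars => R | ComplexScalars => R[i] end.

Definition scalar_conj (k : scalar_kind) :
    involutive_rmorphism (scalar_field k) :=
  match k with
  | RealScalars => (idfun : involutive_rmorphism R)
  | ComplexScalars => (Num.conj : involutive_rmorphism R[i])
  end.

Definition of_real (k : scalar_kind) : {rmorphism R -> scalar_field k} :=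
  match k with
  | RealScalars => (idfun : {rmorphism R -> R})
  | ComplexScalars => (real_complex R : {rmorphism R -> R[i]})
  end.

(* On a norm, which is a nonnegative scalar, this is the inverse of
   [of_real]. *)
Definition to_real (k : scalar_kind) : scalar_field k -> R :=
  match k with
  | RealScalars => (fun x : R => x)
  | ComplexScalars => (fun z : R[i] => complex.Re z)
  end.

End scalars.

Section subspaces.
Variables (K : numFieldType) (H : normedModType K).

Record closed_subspace := ClosedSubspace {
  subspace_pred :> {pred H};
  subspace_submod : submod_closed subspace_pred;
  subspace_closed : closed [set x | x \in subspace_pred] }.

Definition nontrivial (F : closed_subspace) := exists2 x, x \in F & x != 0.

Variable F : closed_subspace.

HB.instance Definition _ :=
  GRing.isSubmodClosed.Build K H (subspace_pred F) (subspace_submod F).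

(* [F] as a normed space in its own right, with the norm of [H]. *)
Definition carrier := {x : H | x \in subspace_pred F}.

HB.instance Definition _ := SubType.on carrier.
HB.instance Definition _ := [Choice of carrier by <:].
HB.instance Definition _ := [SubChoice_isSubLmodule of carrier by <:].

Definition carrier_norm (x : carrier) : K := `|val x|.

Fact carrier_normD x y :
  carrier_norm (x + y) <= carrier_norm x + carrier_norm y.
Proof. by rewrite /carrier_norm raddfD ler_normD. Qed.

Fact carrier_normZ (a : K) x : carrier_norm (a *: x) = `|a| * carrier_norm x.
Proof. by rewrite /carrier_norm linearZ normrZ. Qed.

Fact carrier_norm_eq0 x : carrier_norm x = 0 -> x = 0.
Proof. by move=> /normr0_eq0 x0; apply: val_inj; rewrite raddf0. Qed.

HB.instance Definition _ := Lmodule_isNormed.Build K carrier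
  carrier_normD carrier_normZ carrier_norm_eq0.

End subspaces.

Definition spectrum (K : numFieldType) (V : normedModType K) (T : V -> V) :
    set K :=
  [set l | ~ exists S : {linear V -> V},
     [/\ continuous S, cancel (fun x => T x - l *: x) S
       & cancel S (fun x => T x - l *: x)]].

Section projectors.
Variables (K : numFieldType) (H : normedModType K) (dot : H -> H -> K).

(* [P_F], with [F] itself as codomain: the [y] in [F] such that [x - y] is
   orthogonal to [F]. *)
Definition proj_onto (F : closed_subspace H) (x : H) : carrier F :=
  xget 0 [set y | forall z : carrier F, dot (x - val y) (val z) = 0].

Definition projector (F : closed_subspace H) (x : H) : H := val (proj_onto F x).

(* [(P_F P_G)|_F], as an operator from [F] to [F]. *)
Definition proj_comp (F G : closed_subspace H) (x : carrier F) : carrier F :=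
  proj_onto F (projector G (val x)).

End projectors.

Section angles_and_gap.
Variables (R : realType) (k : scalar_kind).
Variables (H : normedModType (scalar_field R k)) (dot : H -> H -> scalar_field R k).

Definition angles (F G : closed_subspace H) : set R :=
  [set theta | exists sigma : R, [/\ theta = acos sigma, 0 <= sigma
     & spectrum (@proj_comp _ H dot F G) (of_real R k (sigma ^+ 2))]].

Definition opnorm (V W : normedModType (scalar_field R k)) (T : V -> W) : R :=
  sup [set to_real `|T x| | x in [set x | `|x| <= 1]].

Definition gap (F F' : closed_subspace H) : R :=
  opnorm (fun x => projector dot F x - projector dot F' x).

End angles_and_gap.

Section hausdorff_distance.
Variable R : realType.

Definition dist_to_set (u : R) (S : set R) : R := inf [set `|u - v| | v in S].

Definition hausdorff_dist (S1 S2 : set R) : R :=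
  Num.max (sup [set dist_to_set u S2 | u in S1])
          (sup [set dist_to_set v S1 | v in S2]).

End hausdorff_distance.

(* Main.v *)
Require Import Defs.
From HB Require Import structures.
From mathcomp Require Import all_boot all_order all_algebra.
From mathcomp Require Import all_classical all_reals all_analysis.
From mathcomp Require Import complex ring lra.
Set Implicit Arguments.
Unset Strict Implicit.
Unset Printing Implicit Defensive.
Import Order.TTheory GRing.Theory Num.Theory.
Import numFieldNormedType.Exports.
Local Open Scope classical_set_scope.
Local Open Scope ring_scope.

(** Write [P], [P'], [Q] for the orthogonal projectors onto [F], [F'], [G] and
    [d] for the gap. The operator [P Q] on [F] is symmetric with values between
    [0] and [1], so its spectrum consists of approximate eigenvalues
    ([spectrum_angle_value]) lying in [[0, 1]] ([angle_value_bounds]), and the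
    two sets to compare are the sets of approximate eigenvalues of [P Q] on [F]
    and of [P' Q] on [F'] ([cos_sqr_angles]). They act on different spaces; the
    idea is to move both to [G].

    For [l != 0] the map [x |-> Q x] turns approximate eigenvectors of [P Q] on
    [F] into approximate eigenvectors of [Q P] on [G], and conversely
    ([angle_value_sym]). On [G] the operators [Q P] and [Q P'] differ by at
    most [d] in norm, and an approximate eigenvalue of a symmetric operator
    moves by at most the norm of a symmetric perturbation
    ([symmetric_approx_eigenvalue]). This yields an approximate eigenvalue [l']
    of [Q P'] on [G] with [|l - l'| <= d], and when [d < l] it is nonzero and
    comes from one of [P' Q] on [F'] ([angle_value_perturb]).

    If [d < 1 - l], the same argument applies to the orthogonal complement of
    [G], because replacing [Q] by [1 - Q] replaces [l] by [1 - l]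
    ([angle_value_compl]). In the remaining case [1 - d <= l <= d], and then
    every point of [[0, 1]] is within [d] of [l] ([angle_value_dist]).

    Only real numbers [l] matter, so all the estimates are made in the real
    inner product space obtained from [H] by taking the real part of the inner
    product and restricting scalars. Existence of projections and invertibility
    of symmetric operators that are bounded below both come from one least
    squares lemma ([least_squares]). *)

(** * Real inner product spaces *)

Record inner_product (R : realType) (V : lmodType R) (b : V -> V -> R) : Prop :=
  InnerProduct {
    ipC : forall x y, b x y = b y x;
    ipDl : forall x y z, b (x + y) z = b x z + b y z;
    ipZl : forall a x y, b (a *: x) y = a * b x y;
    ip_ge0 : forall x, 0 <= b x x;
    ip_eq0 : forall x, b x x = 0 -> x = 0 }.

Section RealInnerProduct.
Variables (R : realType) (V : lmodType R) (b : V -> V -> R).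
Hypothesis bI : inner_product b.

Implicit Types (x y z : V) (P Q L T : {linear V -> V}) (D W : set V).

Lemma ipDr x y z : b x (y + z) = b x y + b x z.
Proof. by rewrite ipC // ipDl // !(ipC bI _ x). Qed.

Lemma ipZr a x y : b x (a *: y) = a * b x y.
Proof. by rewrite ipC // ipZl // (ipC bI y). Qed.

Lemma ipNl x y : b (- x) y = - b x y.
Proof. by rewrite -scaleN1r ipZl // mulN1r. Qed.

Lemma ipNr x y : b x (- y) = - b x y.
Proof. by rewrite ipC // ipNl (ipC bI y). Qed.

Definition ipE := (ipDl bI, ipDr, ipZl bI, ipZr, ipNl, ipNr).

Definition nrm x := Num.sqrt (b x x).

Lemma ip0l x : b 0 x = 0.
Proof. by rewrite -(scale0r (0 : V)) ipZl // mul0r. Qed.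

Lemma nrm0 : nrm 0 = 0.
Proof. by rewrite /nrm ip0l sqrtr0. Qed.

Lemma nrm_ge0 x : 0 <= nrm x. Proof. exact: sqrtr_ge0. Qed.

Lemma sqr_nrm x : nrm x ^+ 2 = b x x.
Proof. by rewrite sqr_sqrtr // ip_ge0. Qed.

Lemma nrm_le x r : 0 <= r -> b x x <= r ^+ 2 -> nrm x <= r.
Proof. by move=> r0 h; rewrite -(ler_pXn2r (n := 2)) ?nnegrE ?nrm_ge0// sqr_nrm. Qed.

Lemma ler_sqr_nrm x r : nrm x <= r -> nrm x ^+ 2 <= r ^+ 2.
Proof.
move=> h; have r_ge0 := le_trans (nrm_ge0 x) h.
by rewrite ler_pXn2r ?nnegrE ?nrm_ge0.
Qed.

Lemma nrm_eq0 x : nrm x = 0 -> x = 0.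
Proof. by move=> h; apply: (ip_eq0 bI); rewrite -sqr_nrm h expr0n. Qed.

Lemma nrm_gt0 x : x != 0 -> 0 < nrm x.
Proof.
move=> x0; rewrite lt0r nrm_ge0 andbT.
by apply: contra x0 => /eqP/nrm_eq0 ->.
Qed.

Lemma nrm_neq0 x : 0 < nrm x -> x != 0.
Proof. by apply: contraTneq => ->; rewrite nrm0 ltxx. Qed.

Lemma nrmZ a x : nrm (a *: x) = `|a| * nrm x.
Proof. by rewrite /nrm !ipE mulrA -expr2 sqrtrM ?sqr_ge0// sqrtr_sqr. Qed.

Lemma nrmN x : nrm (- x) = nrm x.
Proof. by rewrite /nrm !ipE opprK. Qed.

Lemma cauchy_schwarz x y : b x y <= nrm x * nrm y.
Proof.
have [y0|y0] := eqVneq (nrm y) 0.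
  by rewrite y0 mulr0 (nrm_eq0 y0) ipC // ip0l.
have yp : 0 < nrm y by rewrite lt0r y0 nrm_ge0.
have := ip_ge0 bI (nrm y *: x - nrm x *: y).
rewrite !ipE -!sqr_nrm (ipC bI y x) => h.
have [xp|xp] := ltP 0 (nrm x); last first.
  have x0 : nrm x = 0 by apply/eqP; rewrite eq_le xp nrm_ge0.
  by rewrite x0 mul0r (nrm_eq0 x0) ip0l.
have p : 0 < nrm x * nrm y by exact: mulr_gt0.
rewrite -subr_ge0 -(pmulr_rge0 _ p); nra.
Qed.

Lemma cauchy_schwarz_abs x y : `|b x y| <= nrm x * nrm y.
Proof.
rewrite ler_norml cauchy_schwarz andbT lerNl -ipNl.
by rewrite -(nrmN x) cauchy_schwarz.
Qed.

Lemma ler_nrmD x y : nrm (x + y) <= nrm x + nrm y.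
Proof.
apply: nrm_le; first by rewrite addr_ge0 ?nrm_ge0.
rewrite !ipE (ipC bI y x) -!sqr_nrm sqrrD.
have := cauchy_schwarz x y; lra.
Qed.

Definition real_subspace W := forall a x y, W x -> W y -> W (a *: x + y).

Definition symmetric_on W T := forall x y, W x -> W y -> b (T x) y = b x (T y).

(** * Approximate eigenvalues of symmetric operators *)

Definition approx_eigenvalue W (T : V -> V) (m : R) :=
  forall e, 0 < e ->
    exists x, [/\ W x, x != 0 & nrm (T x - m *: x) <= e * nrm x].

Section Symmetric.
Variables (W : set V) (T : {linear V -> V}) (C d : R).
Hypotheses (W_sub : real_subspace W) (TW : forall x, W x -> W (T x)).
Hypotheses (T_sym : symmetric_on W T).
Hypothesis T_bounded : forall x, W x -> nrm (T x) <= C * nrm x.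
Hypothesis C_gt0 : 0 < C.
Hypothesis T_small :
  forall e, 0 < e -> exists x, [/\ W x, x != 0 & nrm (T x) <= (d + e) * nrm x].

Let S := [set nrm (T x) / nrm x | x in [set x | W x /\ x != 0]].
Let m := inf S.

Let S_inf : has_inf S.
Proof.
split; last by exists 0 => _ [x _ <-]; rewrite divr_ge0 ?nrm_ge0.
by have [x [Wx x0 _]] := T_small ltr01; exists (nrm (T x) / nrm x), x.
Qed.

Let m_ge0 : 0 <= m.
Proof.
by apply: lb_le_inf; [case: S_inf|move=> _ [x _ <-]; rewrite divr_ge0 ?nrm_ge0].
Qed.

Let m_le x : W x -> m * nrm x <= nrm (T x).
Proof.
have [->|x0] := eqVneq x 0.
  by rewrite linear0 nrm0 mulr0.
move=> Wx; rewrite -ler_pdivlMr ?nrm_gt0//; apply: ge_inf; first by case: S_inf.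
by exists x.
Qed.

Let m_led : m <= d.
Proof.
apply/ler_addgt0Pr => e e0; have [x [Wx x0 h]] := T_small e0.
apply: (le_trans (y := nrm (T x) / nrm x)); last by rewrite ler_pdivrMr ?nrm_gt0.
by apply: ge_inf; [case: S_inf|exists x].
Qed.

(** With [A = T ^ 2 - m ^ 2], which is positive on [W] as [m] is the lower bound
    of [T], this says that [|A x| ^ 2 <= C ^ 2 <A x, x>]: a vector that nearly
    attains [m] is nearly in the kernel of [A]. *)
Lemma symmetric_square_residual x : W x ->
  nrm (T (T x) - m ^+ 2 *: x) ^+ 2 <= C ^+ 2 * (nrm (T x) ^+ 2 - m ^+ 2 * nrm x ^+ 2).
Proof.
move=> Wx; set q := T (T x) - m ^+ 2 *: x.
have Wq : W q by rewrite /q addrC -scaleNr; apply: W_sub => //; do 2 apply: TW.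
(* Positivity of A at a gradient step x - t A x; t = C ^- 2 is the optimal
   step as |T q| <= C |q|. *)
pose y := - (C ^- 2) *: q + x.
have Wy : W y by exact: W_sub.
have : m ^+ 2 * nrm y ^+ 2 <= nrm (T y) ^+ 2.
  by rewrite -exprMn ler_pXn2r ?nnegrE ?mulr_ge0 ?nrm_ge0// m_le.
have hq : nrm (T q) ^+ 2 <= C ^+ 2 * nrm q ^+ 2.
  by rewrite -exprMn; apply: ler_sqr_nrm; exact: T_bounded.
have Tqx : b (T q) (T x) = b q q + m ^+ 2 * b q x.
  rewrite T_sym //; last exact: TW.
  by rewrite -[in RHS]ipZr -ipDr /q subrK.
have Ty : T y = - C ^- 2 *: T q + T x by rewrite /y linearD linearZ.
clearbody q; rewrite Ty !sqr_nrm in hq *; rewrite /y !ipE.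
rewrite (ipC bI x q) (ipC bI (T x) (T q)) Tqx.
set t := C ^- 2; have t0 : 0 < t by rewrite invr_gt0 exprn_gt0.
have tC : C ^+ 2 = t^-1 by rewrite invrK.
have ht : t * b (T q) (T q) <= b q q.
  by rewrite -ler_pdivlMl // /t invrK.
move=> h; rewrite tC ler_pdivlMl //.
have m2 : 0 <= m ^+ 2 * (t ^+ 2 * b q q) 
  by apply: mulr_ge0 (sqr_ge0 _) (mulr_ge0 (sqr_ge0 _) (ip_ge0 bI _)).
nra.
Qed.

(** As [T ^ 2 - m ^ 2 = (T - m) (T + m)] has approximate null vectors, so has one
    of the two factors; hence [m] or [- m] is an approximate eigenvalue, where
    [m], the infimum of [|T x| / |x|] over [W], is at most [d]. *)
Lemma symmetric_approx_eigenvalue :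
  exists2 mu, `|mu| <= d & approx_eigenvalue W T mu.
Proof.
suff [h|h] : approx_eigenvalue W T m \/ approx_eigenvalue W T (- m).
- by exists m => //; rewrite ger0_norm.
- by exists (- m) => //; rewrite normrN ger0_norm.
have [|/existsNP[e1 /not_implyP[e1_gt0 N1]]] :=
  pselect (approx_eigenvalue W T (- m)); first by right.
left => e e_gt0.
have residual_small r : 0 < r -> exists x, [/\ W x, x != 0 &
    nrm (T (T x) - m ^+ 2 *: x) <= r * nrm x].
  move=> r_gt0.
  have [s s_gt0 sr] : exists2 s, 0 < s & C ^+ 2 * (s * (2 * m + s)) <= r ^+ 2.
    (* for s <= 1 the left-hand side is at most C ^ 2 s (2 m + 1) *)
    exists (Num.min 1 (r ^+ 2 / (C ^+ 2 * (2 * m + 1)))).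
      rewrite lt_min ltr01 divr_gt0 ?exprn_gt0// mulr_gt0 ?exprn_gt0//.
      by rewrite ltr_wpDl ?mulr_ge0.
    set s := Num.min _ _.
    have s1 : s <= 1 by rewrite ge_min lexx.
    have s2 : s * (C ^+ 2 * (2 * m + 1)) <= r ^+ 2.
      rewrite -ler_pdivlMr ?ge_min ?lexx ?orbT// mulr_gt0 ?exprn_gt0//.
      by rewrite ltr_wpDl ?mulr_ge0.
    have s0 : 0 <= s.
      by rewrite le_min ler01 divr_ge0 ?sqr_ge0// mulr_ge0 ?sqr_ge0// addr_ge0 ?mulr_ge0.
    apply: le_trans s2; rewrite [leRHS]mulrCA; apply: ler_wpM2l; first exact: sqr_ge0.
    by apply: ler_wpM2l => //; rewrite lerD2l.
  have [_ [x [Wx x0] <-] h] := inf_adherent s_gt0 S_inf.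
  exists x; split=> //; apply: nrm_le; first by rewrite mulr_ge0 ?nrm_ge0 ?ltW.
  rewrite -sqr_nrm; apply: le_trans (symmetric_square_residual Wx) _.
  have xp := nrm_gt0 x0.
  have {}h : nrm (T x) <= (m + s) * nrm x by rewrite -ler_pdivrMr ?ltW.
  have {}h : nrm (T x) ^+ 2 <= ((m + s) * nrm x) ^+ 2.
    exact: ler_sqr_nrm.
  apply: (le_trans (y := C ^+ 2 * (s * (2 * m + s)) * nrm x ^+ 2)); last first.
    by rewrite exprMn; apply: ler_wpM2r => //; exact: sqr_ge0.
  by rewrite -mulrA; apply: ler_wpM2l; [exact: sqr_ge0|nra].
have [x [Wx x0 h]] := residual_small _ (mulr_gt0 e_gt0 e1_gt0).
have xp := nrm_gt0 x0.
(* T + m is bounded below, so (T + m) x is an approximate eigenvector for m *)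
have large : e1 * nrm x < nrm (T x + m *: x).
  rewrite ltNge; apply/negP => le; apply: N1; exists x; split=> //.
  by rewrite scaleNr opprK.
exists (m *: x + T x); split.
- by apply: W_sub => //; exact: TW.
- by apply: nrm_neq0; rewrite addrC; apply: le_lt_trans large; rewrite mulr_ge0 ?ltW.
rewrite linearD linearZ /= scalerDr scalerA -expr2.
rewrite [X in nrm X](_ : _ = T (T x) - m ^+ 2 *: x).
  apply: (le_trans h); rewrite -mulrA ler_pM2l// ltW//.
  by rewrite [m *: x + _]addrC.
by rewrite opprD [m *: T x + _]addrC addrACA subrr addr0.
Qed.

End Symmetric.

(** * Angles between the ranges of two projectors *)

Record orthoprojector P : Prop := Orthoprojector {
  proj_idem : forall x, P (P x) = P x;
  proj_sym : forall x y, b (P x) y = b x (P y) }.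

Definition range_of P : set V := [set x | P x = x].

(** The squared cosines of the angles from the range of [P] to the range of [Q],
    seen as approximate eigenvalues instead of as points of a spectrum. *)
Definition angle_value P Q (l : R) := approx_eigenvalue (range_of P) (P \o Q) l.

Lemma nrm_proj P x : orthoprojector P -> nrm (P x) <= nrm x.
Proof.
move=> HP; apply: nrm_le; first exact: nrm_ge0.
have := ip_ge0 bI (x - P x).
rewrite !ipE (ipC bI (P x) x) sqr_nrm proj_sym // proj_idem //; lra.
Qed.

Lemma orthoprojector_compl P :
  orthoprojector P -> orthoprojector (idfun \- P).
Proof.
move=> HP; split=> [x|x y] /=.
  by rewrite linearB /= proj_idem // subrr subr0.
by rewrite !ipE proj_sym.
Qed.

Lemma subspace_range P : real_subspace (range_of P).
Proof. by move=> a x y Px Py; rewrite /range_of /= linearP Px Py. Qed.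

(** If [x] is an approximate eigenvector of [P Q] for [l], then [Q x] is one of
    [Q P]. For [l = 0] this fails, since [Q x] may then be too small: a plane
    makes the angle [pi / 2] with a line inside it, but not conversely. *)
Lemma angle_value_sym P Q l : orthoprojector P -> orthoprojector Q ->
  l != 0 -> angle_value P Q l -> angle_value Q P l.
Proof.
move=> HP HQ l0 ev e e_gt0; have lp : 0 < `|l| / 2 by rewrite divr_gt0 ?normr_gt0.
(* r <= |l| / 2 keeps Q x away from 0, and r <= e |l| / 2 gives the estimate *)
pose r := Num.min 1 e * (`|l| / 2).
have m_gt0 : 0 < Num.min 1 e by rewrite lt_min ltr01.
have r_gt0 : 0 < r by rewrite mulr_gt0.
have [x [Px x0 /= h]] := ev r r_gt0; have xp := nrm_gt0 x0.
have lower : `|l| / 2 * nrm x <= nrm (Q x).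
  have := ler_nrmD (l *: x - P (Q x)) (P (Q x)).
  rewrite subrK nrmZ -(nrmN (l *: x - _)) opprB.
  have rl : r <= `|l| / 2 by rewrite ger_pMl // ge_min lexx.
  have := nrm_proj (Q x) HP; have := ler_wpM2r (ltW xp) rl; lra.
exists (Q x); split=> [||/=].
- exact: proj_idem.
- by apply: nrm_neq0; apply: lt_le_trans lower; rewrite mulr_gt0.
- rewrite -[P (Q x)]/((P \o Q) x) -linearZ -linearB /=.
  apply: le_trans (nrm_proj _ HQ) _; apply: (le_trans h).
  apply: (le_trans (y := e * (`|l| / 2 * nrm x))); last by rewrite ler_pM2l.
  by rewrite mulrA ler_pM2r// /r ler_pM2r// ge_min lexx orbT.
Qed.

(** An approximate eigenvalue is close to [<P Q x, x> / |x| ^ 2], which for [x] in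
    the range of [P] is [|Q x| ^ 2 / |x| ^ 2]. *)
Lemma angle_value_bounds P Q l : orthoprojector P -> orthoprojector Q ->
  angle_value P Q l -> 0 <= l <= 1.
Proof.
move=> HP HQ ev.
have near e : 0 < e -> - e <= l <= 1 + e.
  move=> e_gt0; have [x [Px x0 /= h]] := ev e e_gt0; have xp := nrm_gt0 x0.
  have := cauchy_schwarz_abs (P (Q x) - l *: x) x.
  rewrite !ipE proj_sym // Px -(proj_idem HQ x) proj_sym // proj_idem //.
  rewrite -!sqr_nrm ler_norml => /andP[h1 h2].
  have h3 : nrm (P (Q x) - l *: x) * nrm x <= e * nrm x ^+ 2.
    by rewrite expr2 mulrA ler_wpM2r// ltW.
  have h4 := ler_sqr_nrm (nrm_proj x HQ).
  have h5 : 0 <= nrm (Q x) ^+ 2 by exact: sqr_ge0.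
  have x2 : 0 < nrm x ^+ 2 by rewrite exprn_gt0.
  rewrite -(ler_pM2r x2) -[l <= _](ler_pM2r x2); apply/andP; split; lra.
by apply/andP; split; apply/ler_addgt0Pr => e /near/andP[]; lra.
Qed.

(** On the range of [P], the operator [P (1 - Q)] is [1 - P Q]. *)
Lemma angle_value_compl P Q l :
  angle_value P Q l -> angle_value P (idfun \- Q) (1 - l).
Proof.
move=> ev e e_gt0; have [x [Px x0 h]] := ev e e_gt0; exists x; split=> //=.
rewrite linearB /= Px scalerBl scale1r opprB addrC subrKA -nrmN opprB.
exact: h.
Qed.

(** The operators [Q P] and [Q P'] act on the common space [range_of Q], where
    they differ by at most [d]; [symmetric_approx_eigenvalue] is applied there
    to [Q P' - l]. The condition [d < l] keeps the values found away from [0],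
    so that [angle_value_sym] applies on the way back too. *)
Lemma angle_value_perturb P P' Q d l :
    orthoprojector P -> orthoprojector P' -> orthoprojector Q ->
    (forall x, nrm (P x - P' x) <= d * nrm x) -> 0 <= d < l ->
  angle_value P Q l -> exists2 l', `|l - l'| <= d & angle_value P' Q l'.
Proof.
move=> HP HP' HQ dPP' /andP[d_ge0 d_l] /angle_value_sym evP.
have l_gt0 := le_lt_trans d_ge0 d_l; have {}evP := evP HP HQ (lt0r_neq0 l_gt0).
have [T TE] : exists T : {linear V -> V}, forall x, T x = Q (P' x) - l *: x.
  by exists ((Q \o P') \- (l \*: idfun)).
have [|x Qx|x y Qx Qy|x Qx||e e_gt0|mu mu_d evT] :=
  @symmetric_approx_eigenvalue (range_of Q) T (1 + l) d.
- exact: subspace_range.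
- by rewrite /range_of /= TE linearB linearZ /= proj_idem // Qx.
- rewrite !TE !ipE (proj_sym HQ) Qy (proj_sym HP').
  by rewrite -(proj_sym HQ) Qx.
- rewrite TE mulrDl mul1r; apply: le_trans (ler_nrmD _ _) _.
  rewrite nrmN nrmZ gtr0_norm // lerD2r.
  by apply: le_trans (nrm_proj _ HQ) (nrm_proj _ HP').
- by rewrite ltr_wpDl.
- have [x [Qx x0 /= h]] := evP e e_gt0; exists x; split=> //.
  rewrite TE (_ : _ - _ = Q (P x) - l *: x - Q (P x - P' x)); last first.
    by rewrite linearB /= opprB [RHS]addrC addrA subrK.
  apply: le_trans (ler_nrmD _ _) _; rewrite addrC mulrDl nrmN lerD //.
  exact: le_trans (nrm_proj _ HQ) (dPP' x).
- exists (l + mu); first by rewrite opprD addNKr normrN.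
  have lmu : l + mu != 0.
    apply/lt0r_neq0; move: mu_d; rewrite ler_norml => /andP[+ _]; lra.
  apply: angle_value_sym => // e e_gt0; have [x [Qx x0 h]] := evT e e_gt0.
  by exists x; split=> //; rewrite scalerDl opprD addrA -TE.
Qed.

(** Either [d < l], or [d < 1 - l] and the previous lemma applies to the
    complement of [Q], or [l] is in the middle interval. *)
Lemma angle_value_dist P P' Q d l :
    orthoprojector P -> orthoprojector P' -> orthoprojector Q ->
    (forall x, nrm (P x - P' x) <= d * nrm x) -> 0 <= d -> angle_value P Q l ->
  (exists2 l', `|l - l'| <= d & angle_value P' Q l') \/ 1 - d <= l <= d.
Proof.
move=> HP HP' HQ dPP' d_ge0 ev.
have [l_d|d_l] := leP l d; last first.
  by left; apply: (angle_value_perturb HP); rewrite ?d_ge0.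
have [l_d'|d_l'] := leP (1 - d) l; first by right.
have [|l' ll' ev'] := angle_value_perturb HP HP' (orthoprojector_compl HQ) dPP' _
  (angle_value_compl ev).
  by rewrite d_ge0 ltrBrDr -ltrBrDl.
left; exists (1 - l'); first by move: ll'; rewrite distrC !opprB addrCA; lra.
have := angle_value_compl ev'.
by move=> h e /h[x [Px x0 /= hx]]; exists x; split=> //=; rewrite -{1}(subKr x (Q x)).
Qed.

(** * Least squares on a complete subspace *)

Definition seq_complete D := forall u : nat -> V, (forall n, D (u n)) ->
  (forall e, 0 < e -> exists N, forall m n, (N <= m)%N -> (N <= n)%N ->
    nrm (u m - u n) <= e) ->
  exists2 x, D x & forall e, 0 < e -> exists N, forall n, (N <= n)%N ->
    nrm (u n - x) <= e.

Section LeastSquares.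
Variables (D : set V) (L : {linear V -> V}) (c C : R) (y : V).
Hypotheses (D_sub : real_subspace D) (D0 : D 0) (D_complete : seq_complete D).
Hypotheses (c_gt0 : 0 < c) (C_ge0 : 0 <= C).
Hypothesis L_lower : forall x, D x -> c * nrm x <= nrm (L x).
Hypothesis L_upper : forall x, D x -> nrm (L x) <= C * nrm x.

Let S := [set nrm (y - L x) ^+ 2 | x in D].

Let S_inf : has_inf S.
Proof.
by split; [exists (nrm (y - L 0) ^+ 2), 0|exists 0 => _ [x _ <-]; exact: sqr_ge0].
Qed.

Let subD u v : D u -> D v -> D (u - v).
Proof. by move=> Du Dv; rewrite addrC -scaleN1r; apply: D_sub. Qed.

(** The residual of a near minimizer is nearly orthogonal to the image of [L].
    This serves twice: for two near minimizers it bounds the norm of the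
    difference of their images, and at the limit it gives orthogonality. *)
Let near_orthogonal e x z : 0 < e -> D x -> D z ->
  nrm (y - L x) ^+ 2 <= inf S + e ^+ 2 -> `|b (y - L x) (L z)| <= e * nrm (L z).
Proof.
move=> e_gt0 Dx Dz near.
have [w0|w0] := eqVneq (L z) 0; first by rewrite w0 ipC // ip0l normr0 nrm0 mulr0.
have w_gt0 := nrm_gt0 w0; set v := y - L x in near *; set a := b _ _.
set w := nrm (L z) in w_gt0 *.
have w2_gt0 : 0 < w ^+ 2 by rewrite exprn_gt0.
(* a / w ^ 2 is the multiple of z that decreases the residual most *)
have : inf S <= nrm (y - L (a / w ^+ 2 *: z + x)) ^+ 2.
  by apply: ge_inf; [case: S_inf|exists (a / w ^+ 2 *: z + x) => //; exact: D_sub].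
rewrite (_ : y - _ = v - (a / w ^+ 2) *: L z); last first.
  by rewrite linearD linearZ /= opprD addrCA addrC.
clearbody v.
rewrite sqr_nrm !ipE (ipC bI (L z) v) -/a -!sqr_nrm -/w => h.
have {h} aw : a ^+ 2 / w ^+ 2 <= e ^+ 2.
  rewrite -(ler_pM2r w2_gt0) divfK ?lt0r_neq0//.
  move: h; set t := a / w ^+ 2; have -> : a = t * w ^+ 2 by rewrite /t divfK ?lt0r_neq0.
  nra.
move: aw; rewrite ler_pdivrMr// -exprMn => aw.
have ew : 0 <= e * w by rewrite mulr_ge0 // ltW.
by rewrite -(ler_pXn2r (n := 2)) ?nnegrE // real_normK ?num_real.
Qed.

(** A minimizing sequence is Cauchy because [L] is bounded below on [D]. *)
Lemma least_squares :
  exists2 x, D x & forall z, D z -> b (y - L x) (L z) = 0.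
Proof.
have near n : exists x, D x /\ nrm (y - L x) ^+ 2 <= inf S + n.+1%:R^-1 ^+ 2.
  have e_gt0 : 0 < n.+1%:R^-1 ^+ 2 :> R by rewrite exprn_gt0 // invr_gt0.
  have [_ [x Dx <-] /ltW h] := inf_adherent e_gt0 S_inf.
  by exists x.
have [u /all_and2[Du near_u]] := choice near.
have orth n z : D z -> `|b (y - L (u n)) (L z)| <= n.+1%:R^-1 * nrm (L z).
  by move=> Dz; apply: near_orthogonal; rewrite ?invr_gt0.
have small e : 0 < e -> exists N, forall n, (N <= n)%N -> n.+1%:R^-1 <= e :> R.
  move=> e_gt0; have [N /ltW h] := ltr_add_invr e_gt0; rewrite add0r in h.
  exists N => n Nn; apply: le_trans h.
  by rewrite lef_pV2 ?posrE ?ltr0n// ler_nat.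
have [|x Dx ux] := D_complete Du.
  move=> e e_gt0; have [|N hN] := small (c * e / 2); first by rewrite divr_gt0 ?mulr_gt0.
  exists N => m n Nm Nn; have Dz := subD (Du m) (Du n).
  rewrite -(ler_pM2l c_gt0); apply: le_trans (L_lower Dz) _.
  set w := L (u m - u n).
  have [->|/nrm_gt0 w_gt0] := eqVneq w 0; first by rewrite nrm0 mulr_ge0 ?ltW.
  rewrite -(ler_pM2r w_gt0) -expr2 sqr_nrm {1}/w linearB /=.
  rewrite (_ : L (u m) - L (u n) = (y - L (u n)) - (y - L (u m))); last first.
    by rewrite opprB [RHS]addrC addrA subrK.
  rewrite ipDl // ipNl.
  have := orth n _ Dz; have := orth m _ Dz; rewrite -/w !ler_norml.
  have := ler_wpM2r (ltW w_gt0) (hN _ Nm); have := ler_wpM2r (ltW w_gt0) (hN _ Nn).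
  move=> h1 h2 /andP[h3 _] /andP[_ h6].
  rewrite (splitr (c * e)) mulrDl; apply: lerD; first exact: le_trans h6 h1.
  by rewrite lerNl; apply: le_trans h3; rewrite lerN2.
exists x => // z Dz; apply/eqP; rewrite -normr_le0; apply/ler_addgt0Pl => e e_gt0.
rewrite addr0; pose r := e / (nrm (L z) * (1 + C) + 1).
have k_gt0 : 0 < nrm (L z) * (1 + C) + 1.
  by rewrite ltr_wpDl// mulr_ge0 ?nrm_ge0 ?addr_ge0.
have r_gt0 : 0 < r by rewrite divr_gt0.
have [N1 hN1] := small _ r_gt0; have [N2 hN2] := ux _ r_gt0.
pose n := maxn N1 N2.
have {}hN1 := hN1 n (leq_maxl _ _); have {}hN2 := hN2 n (leq_maxr _ _).
rewrite (_ : y - L x = (y - L (u n)) + L (u n - x)); last first.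
  by rewrite linearB addrA subrK.
rewrite ipDl //; apply: le_trans (ler_normD _ _) _.
have h1 : `|b (y - L (u n)) (L z)| <= r * nrm (L z).
  by apply: le_trans (orth n z Dz) _; apply: ler_wpM2r => //; exact: nrm_ge0.
have h2 : `|b (L (u n - x)) (L z)| <= C * r * nrm (L z).
  apply: le_trans (cauchy_schwarz_abs _ _) _; apply: ler_wpM2r; first exact: nrm_ge0.
  apply: le_trans (L_upper (subD (Du n) Dx)) _; exact: ler_wpM2l.
have -> : e = r * (nrm (L z) * (1 + C) + 1) by rewrite /r divfK // lt0r_neq0.
lra.
Qed.

End LeastSquares.

(** The least squares residual [w] is orthogonal to the image of [L], so by
    symmetry [L w = 0], and [w = 0] as [L] is bounded below. *)
Lemma symmetric_surjective D L c C :
    real_subspace D -> D 0 -> seq_complete D -> 0 < c -> 0 <= C ->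
    (forall x, D x -> c * nrm x <= nrm (L x)) ->
    (forall x, D x -> nrm (L x) <= C * nrm x) ->
    (forall x, D x -> D (L x)) -> symmetric_on D L ->
  forall y, D y -> exists2 x, D x & L x = y.
Proof.
move=> D_sub D0 D_complete c_gt0 C_ge0 lower upper DL sym y Dy.
have [x Dx xP] := least_squares y D_sub D0 D_complete c_gt0 C_ge0 lower upper.
have Dw : D (y - L x) by rewrite addrC -scaleN1r; apply: D_sub (DL _ Dx) Dy.
exists x => //; apply/esym/eqP; rewrite -subr_eq0; apply/eqP/nrm_eq0/eqP.
rewrite eq_le nrm_ge0 andbT -(pmulr_rle0 _ c_gt0).
apply: le_trans (lower _ Dw) _; rewrite (_ : L _ = 0) ?nrm0 //.
by apply: (ip_eq0 bI); rewrite -(xP _ (DL _ Dw)) sym //; exact: DL.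
Qed.

End RealInnerProduct.

(** * Real and complex scalars *)

Section Scalars.
Variables (R : realType) (k : scalar_kind).
Local Notation K := (scalar_field R k).
Local Notation toR := (@to_real R k).
Local Notation ofR := (of_real R k).

Lemma of_realK r : toR (ofR r) = r. Proof. by case: k. Qed.

Lemma to_realK (z : K) : 0 <= z -> ofR (toR z) = z.
Proof. by case: k z => //= z z_ge0; rewrite RRe_real // ger0_real. Qed.

Lemma to_realD (z w : K) : toR (z + w) = toR z + toR w.
Proof. by case: k z w => //= -[a b] [c d]. Qed.

Lemma to_realZ a (z : K) : toR (ofR a * z) = a * toR z.
Proof. by case: k z => //= -[c d] /=; rewrite mul0r subr0. Qed.

Lemma to_real_conj (z : K) : toR (scalar_conj R k z) = toR z.
Proof. by case: k z => //= -[c d]. Qed.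

Lemma mul_scalar_conj (z : K) : z * scalar_conj R k z = `|z| ^+ 2.
Proof. by case: k z => /= z; [rewrite real_normK ?num_real|rewrite normCK]. Qed.

Lemma ler_of_real r s : (ofR r <= ofR s) = (r <= s).
Proof. by case: k => //=; rewrite lecR. Qed.

End Scalars.

(** * The real inner product space underlying a Hilbert space *)

(** An alias: for complex scalars [H] already carries a module structure over
    another field, and for real scalars it carries this one only up to
    reduction of [scalar_field]. *)
Definition realified (R : realType) (k : scalar_kind)
  (H : normedModType (scalar_field R k)) : Type := H.

Section Realified.
Variables (R : realType) (k : scalar_kind) (H : normedModType (scalar_field R k)).
Local Notation ofR := (of_real R k).

HB.instance Definition _ := GRing.Zmodule.copy (realified H) H.

Let real_scale (a : R) (x : realified H) : realified H :=
  (ofR a : scalar_field R k) *: (x : H).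

Fact real_scaleA a b x : real_scale a (real_scale b x) = real_scale (a * b) x.
Proof. by rewrite /real_scale scalerA rmorphM. Qed.

Fact real_scale1 : left_id 1 real_scale.
Proof. by move=> x; rewrite /real_scale rmorph1 scale1r. Qed.

Fact real_scaleDr : right_distributive real_scale +%R.
Proof. by move=> a x y; exact: scalerDr. Qed.

Fact real_scaleDl x : {morph real_scale^~ x : a b / a + b}.
Proof. by move=> a b; rewrite /real_scale rmorphD scalerDl. Qed.

HB.instance Definition _ := GRing.Zmodule_isLmodule.Build R (realified H)
  real_scaleA real_scale1 real_scaleDr real_scaleDl.

Lemma realified_scaleE a (x : realified H) : a *: x = ofR a *: (x : H) :> H.
Proof. by []. Qed.

End Realified.

Section HilbertSpace.
Variables (R : realType) (k : scalar_kind).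
Local Notation K := (scalar_field R k).
Local Notation toR := (@to_real R k).
Local Notation ofR := (of_real R k).
Variables (H : completeNormedModType K) (dot : {dot H for scalar_conj R k}).
Hypothesis dot_norm : forall x : H, dot x x = `|x| ^+ 2.
Local Notation V := (realified H).

Definition real_dot (x y : V) : R := toR (dot (x : H) (y : H)).

Lemma dotDl (x y z : H) : dot (x + y) z = dot x z + dot y z.
Proof. exact: linearDl. Qed.

Lemma dotBl (x y z : H) : dot (x - y) z = dot x z - dot y z.
Proof. exact: linearBl. Qed.

Lemma dotC (x y : H) : dot x y = scalar_conj R k (dot y x).
Proof. by rewrite hermC expr0 mul1r. Qed.

Lemma dotZl a (x y : H) : dot (a *: x) y = a * dot x y.
Proof. exact: linearZl_LR. Qed.

Lemma dotZr a (x y : H) : dot x (a *: y) = scalar_conj R k a * dot x y.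
Proof. exact: linearZr_LR. Qed.

Lemma real_dotxx (x : H) : real_dot x x = toR `|x| ^+ 2.
Proof.
rewrite /real_dot dot_norm -[in LHS](to_realK (normr_ge0 x)).
by rewrite -rmorphXn of_realK.
Qed.

Lemma inner_product_real_dot : inner_product real_dot.
Proof.
split.
- by move=> x y; rewrite /real_dot dotC to_real_conj.
- by move=> x y z; rewrite /real_dot dotDl to_realD.
- by move=> a x y; rewrite /real_dot realified_scaleE dotZl to_realZ.
- by move=> x; rewrite real_dotxx sqr_ge0.
- move=> x /eqP; rewrite real_dotxx expf_eq0 /= => /eqP h.
  by apply: normr0_eq0; rewrite -(to_realK (normr_ge0 (x : H))) h rmorph0.
Qed.
Local Notation bI := inner_product_real_dot.
Local Notation nrm := (nrm real_dot).

Lemma nrmE (x : H) : ofR (nrm x) = `|x|.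
Proof.
rewrite -[nrm x]/(Num.sqrt (real_dot x x)) real_dotxx sqrtr_sqr ger0_norm ?to_realK //.
by rewrite -(ler_of_real k) to_realK // rmorph0.
Qed.

Lemma to_real_norm (x : H) : toR `|x| = nrm x.
Proof. by rewrite -nrmE of_realK. Qed.

(** * Orthogonal projection onto a closed subspace *)

Section Subspace.
Variable F : closed_subspace H.

Definition points : set V := [set x | (x : H) \in F].

Lemma subspace_points : real_subspace points.
Proof.
move=> a x y Fx Fy; rewrite /points /= realified_scaleE.
have [_ lin] := subspace_submod F.
exact: lin.
Qed.

Lemma points0 : points 0.
Proof. by have [] := subspace_submod F. Qed.

Lemma seq_complete_points : seq_complete real_dot points.
Proof.
move=> u Fu u_cauchy.
have : cvg ((u : nat -> H) @ \oo).
  apply/cauchy_cvgP/cauchy_exP => e e_gt0.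
  have e2_gt0 : 0 < e / 2 by rewrite divr_gt0.
  have [|N hN] := u_cauchy (toR (e / 2)).
    rewrite lt0r -(ler_of_real k) rmorph0 to_realK ?ltW// andbT.
    by apply/eqP => h; move: (e2_gt0); rewrite -(to_realK (ltW e2_gt0)) h rmorph0 ltxx.
  exists (u N : H); exists N => // n /= Nn; rewrite -ball_normE /=.
  apply: (@le_lt_trans _ _ (e / 2)); last by rewrite ltr_pdivrMr // ltr_pMr // ltr1n.
  rewrite -(nrmE (u N - u n)) -(to_realK (ltW e2_gt0)) ler_of_real.
  exact: hN.
move/cvg_ex => [l ul]; exists (l : V).
  have := @closed_cvg _ _ \oo _ (u : nat -> H) _ (@subspace_closed _ _ F) _ l ul.
  by apply; exists 0 => // n _; exact: Fu.
move=> e e_gt0; have eK : 0 < ofR e.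
  by rewrite lt0r fmorph_eq0 gt_eqF //= -(rmorph0 ofR) ler_of_real ltW.
have [N _ hN] := (cvgrPdist_le _ _).1 ul _ eK; exists N => n Nn.
have := hN n Nn; rewrite /= -nrmE ler_of_real -nrmN ?opprB //.
exact: bI.
Qed.

(** This is [least_squares] for the identity of [F]. It gives orthogonality for
    the real part of the inner product only, but against all scalar multiples
    of [z], which includes one that makes the inner product nonnegative. *)
Lemma orthogonal_projection_exists (x : H) :
  exists y : carrier F, forall z : carrier F, dot (x - val y) (val z) = 0.
Proof.
have [||y Fy yP] := @least_squares R V real_dot bI points idfun 1 1 x
  subspace_points points0 seq_complete_points ltr01 ler01.
- by move=> y _; rewrite mul1r.
- by move=> y _; rewrite mul1r.
exists (Sub (y : H) Fy) => z; set w := x - _.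
have wz a : toR (scalar_conj R k a * dot w (val z)) = 0.
  rewrite -dotZr; apply: (yP (a *: val z)); rewrite /points /= -[_ *: _]addr0.
  by have [F0 lin] := subspace_submod F; apply: lin => //; exact: valP.
have := wz (dot w (val z)); rewrite mulrC mul_scalar_conj => h.
apply/normr0_eq0/eqP; rewrite -sqrf_eq0; apply/eqP.
by rewrite -(to_realK (exprn_ge0 2 (normr_ge0 _))) h rmorph0.
Qed.

Lemma proj_onto_orthogonal (x : H) (z : carrier F) :
  dot (x - val (proj_onto dot F x)) (val z) = 0.
Proof. exact: (xgetPex 0 (orthogonal_projection_exists x)). Qed.

Lemma proj_onto_unique (x : H) (y : carrier F) :
  (forall z : carrier F, dot (x - val y) (val z) = 0) -> proj_onto dot F x = y.
Proof.
move=> yP; apply/eqP; rewrite -subr_eq0; set d := _ - y.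
have dd : dot (val d) (val d) = 0.
  rewrite {1}(_ : val d = (x - val y) - (x - val (proj_onto dot F x))).
    by rewrite dotBl yP proj_onto_orthogonal subr0.
  by rewrite /d raddfB /= opprB [RHS]addrC addrA subrK.
apply/eqP/val_inj; rewrite raddf0; apply/normr0_eq0/eqP.
by rewrite -sqrf_eq0 -dot_norm dd.
Qed.

Lemma proj_onto_linear : linear (proj_onto dot F).
Proof.
move=> a x y; apply: proj_onto_unique => z.
rewrite (_ : _ - _ = a *: (x - val (proj_onto dot F x)) +
  (y - val (proj_onto dot F y))); last first.
  by rewrite linearP /= addrACA -scalerDr.
rewrite dotDl dotZl.
by rewrite !proj_onto_orthogonal mulr0 addr0.
Qed.

Lemma proj_onto_id (x : carrier F) : proj_onto dot F (val x) = x.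
Proof. by apply: proj_onto_unique => z; rewrite subrr linear0l. Qed.

End Subspace.
Lemma real_projector (F : closed_subspace H) :
  exists2 P : {linear V -> V}, orthoprojector real_dot P
    & forall x, P x = projector dot F x.
Proof.
have lin : linear (projector dot F : V -> V).
  by move=> a x y; rewrite /projector realified_scaleE proj_onto_linear linearP.
pose P : {linear V -> V} :=
  HB.pack (projector dot F : V -> V) (GRing.isLinear.Build _ _ _ _ _ lin).
exists P => //; split=> [x|x y]; first by rewrite /= /projector proj_onto_id.
have proj_dot (u v : H) : real_dot (projector dot F u) (projector dot F v) =
    real_dot u (projector dot F v).
  apply/esym/eqP; rewrite -subr_eq0; apply/eqP.
  rewrite -(ipNl bI) -(ipDl bI) /real_dot.
  by rewrite proj_onto_orthogonal -(of_realK k 0) rmorph0.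
by rewrite -[RHS]proj_dot [RHS](ipC bI) [RHS]proj_dot [RHS](ipC bI).
Qed.

(** * The spectrum consists of approximate eigenvalues *)

Section Spectrum.
Variables (F G : closed_subspace H) (P Q : {linear V -> V}).
Hypotheses (P_proj : orthoprojector real_dot P).
Hypotheses (Q_proj : orthoprojector real_dot Q).
Hypothesis PE : forall x, P x = projector dot F x.
Hypothesis QE : forall x, Q x = projector dot G x.

Lemma range_of_points : range_of P = points F.
Proof.
apply/seteqP; split=> x; rewrite /range_of /points /= PE => Fx.
  by rewrite -Fx; exact: valP (proj_onto dot F x).
by rewrite /projector (proj_onto_id (Sub (x : H) Fx)).
Qed.

Variable l : R.
Let T (x : carrier F) : carrier F := proj_comp dot G x - ofR l *: x.
Let L : {linear V -> V} := (P \o Q) \- (l \*: idfun).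

Let val_T x : val (T x) = L (val x).
Proof.
by rewrite /L /= PE QE.
Qed.

Let norm_T x : `|T x| = ofR (nrm (L (val x))).
Proof. by rewrite -val_T nrmE. Qed.

Let T_linear : linear T.
Proof.
move=> a x y; rewrite /T.
have -> : proj_comp dot G (a *: x + y) = a *: proj_comp dot G x + proj_comp dot G y.
  by rewrite /proj_comp /projector linearP proj_onto_linear linearP proj_onto_linear.
by rewrite scalerBr addrACA -opprD scalerDr !scalerA [a * _]mulrC.
Qed.

(** If [l] is not an approximate eigenvalue, then [T], the operator
    [P Q - l] on [F], is bounded below. Being symmetric, it is onto [F], and
    the lower bound makes its inverse continuous. *)
Lemma spectrum_angle_value :
  spectrum (@proj_comp _ H dot F G) (ofR l) -> angle_value real_dot P Q l.
Proof.
move=> spec; apply: contrapT => /existsNP[e /not_implyP[e_gt0 noev]]; apply: spec.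
have L_lower (x : V) : points F x -> e * nrm x <= nrm (L x).
  move=> Fx; have [->|x0] := eqVneq x 0; first by rewrite (nrm0 bI) mulr0 nrm_ge0.
  rewrite leNgt; apply/negP => /ltW h; apply: noev; exists x; split=> //.
  by rewrite range_of_points.
have L_upper (x : V) : points F x -> nrm (L x) <= (1 + `|l|) * nrm x.
  move=> Fx; apply: le_trans (ler_nrmD bI _ _) _.
  rewrite (nrmN bI) (nrmZ bI) mulrDl mul1r lerD2r.
  exact: le_trans (nrm_proj bI _ P_proj) (nrm_proj bI _ Q_proj).
have FL (x : V) : points F x -> points F (L x).
  by move=> Fx; rewrite -[x]/(val (Sub (x : H) Fx : carrier F)) -val_T; exact: valP.
have L_sym : symmetric_on real_dot (points F) L.
  rewrite -range_of_points => x y Px Py.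
  rewrite /= !(ipE bI) (proj_sym P_proj) Py (proj_sym Q_proj).
  by rewrite -[in RHS](proj_sym P_proj) Px.
have T_surj (y : carrier F) : exists x, T x = y.
  have [x Fx Lx] := symmetric_surjective bI (@subspace_points F) (points0 F)
    (@seq_complete_points F) e_gt0 (addr_ge0 ler01 (normr_ge0 l))
    L_lower L_upper FL L_sym (valP y).
  by exists (Sub (x : H) Fx); apply: val_inj; rewrite val_T.
have T_lower x : ofR e * `|x| <= `|T x|.
  by rewrite norm_T -[`|x|]nrmE -rmorphM ler_of_real L_lower //; exact: valP.
have eK : 0 < ofR e by rewrite lt0r fmorph_eq0 gt_eqF //= -(rmorph0 ofR) ler_of_real ltW.
have T_inj : injective T.
  move=> x x' Txx'; apply/eqP; rewrite -subr_eq0 -normr_eq0 eq_le normr_ge0 andbT.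
  rewrite -(pmulr_rle0 _ eK); apply: le_trans (T_lower _) _.
  by rewrite addrC -scaleN1r T_linear Txx' scaleN1r addNr normr0.
have [S TS] := choice T_surj.
have S_linear : linear S by move=> a y z; apply: T_inj; rewrite T_linear !TS.
pose S' : {linear carrier F -> carrier F} :=
  HB.pack S (GRing.isLinear.Build _ _ _ _ _ S_linear).
exists S'; split=> [|x|y]; [|exact/T_inj/TS|exact: TS].
apply/linear_bounded_continuous/linear_boundedP.
exists (ofR e)^-1; split=> [|r er y]; first by rewrite ger0_real // invr_ge0 ltW.
apply: (@le_trans _ _ ((ofR e)^-1 * `|y|)); last by apply: ler_wpM2r (ltW er).
by rewrite ler_pdivlMl // -[in leRHS](TS y).
Qed.

(** A continuous inverse of [T] is bounded, so that [T] is bounded below. *)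
Lemma angle_value_spectrum :
  angle_value real_dot P Q l -> spectrum (@proj_comp _ H dot F G) (ofR l).
Proof.
move=> ev [S [/linear_bounded_continuous/linear_boundedP[M [M_real S_bounded]] TS _]].
have {S_bounded} [r r_gt0 S_bounded] :
    exists2 r : R, 0 < r & forall y, `|S y| <= ofR r * `|y|.
  have M1_gt0 : 0 < `|M| + 1 by rewrite ltr_wpDl.
  have M1E := to_realK (ltW M1_gt0).
  exists (toR (`|M| + 1)) => [|y].
    by rewrite lt_neqAle -(ler_of_real k) M1E rmorph0 ltW // andbT;
       apply/eqP => h; move: M1_gt0; rewrite -M1E -h rmorph0 ltxx.
  rewrite M1E; apply: S_bounded; apply: le_lt_trans (real_ler_norm M_real) _.
  by rewrite ltrDl.
have [|x [Px x0 /= h]] := ev (r^-1 / 2); first by rewrite divr_gt0 ?invr_gt0.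
have Fx : points F x by rewrite -range_of_points.
have := S_bounded (T (Sub (x : H) Fx)); rewrite TS norm_T -[leLHS]nrmE -rmorphM.
rewrite ler_of_real => {}S_bounded.
have := nrm_gt0 bI x0; rewrite ltNge => /negP; apply.
move: h; rewrite -mulrA ler_pdivlMl // => h.
have := le_trans S_bounded h => /=; lra.
Qed.

End Spectrum.
(** The cosine undoes the arc cosine since the values [s] that occur are at most
    [1], by [angle_value_bounds]. *)
Lemma cos_sqr_angles (F G : closed_subspace H) (P Q : {linear V -> V}) :
    orthoprojector real_dot P -> orthoprojector real_dot Q ->
    (forall x, P x = projector dot F x) -> (forall x, Q x = projector dot G x) ->
  [set cos t ^+ 2 | t in angles dot F G] = [set l | angle_value real_dot P Q l].
Proof.
move=> HP HQ PE QE; apply/seteqP; split=> [_ [_ [s [-> s_ge0 sp]] <-]|l /= ev].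
  have ev := spectrum_angle_value HP HQ PE QE sp.
  have /andP[_ s2_le1] := angle_value_bounds bI HP HQ ev.
  have s_le1 : s <= 1 by rewrite -(expr_le1 (n := 2)).
  by rewrite /= acosK // in_itv /= s_le1 (le_trans _ s_ge0) // lerN10.
have /andP[l_ge0 l_le1] := angle_value_bounds bI HP HQ ev.
have sl : Num.sqrt l ^+ 2 = l by rewrite sqr_sqrtr.
exists (acos (Num.sqrt l)); last first.
  rewrite acosK // in_itv /= (le_trans _ (sqrtr_ge0 l)) ?lerN10 //=.
  by rewrite -(expr_le1 (n := 2)) ?sqrtr_ge0 // sl.
by exists (Num.sqrt l); split; rewrite ?sqrtr_ge0 // sl; exact: angle_value_spectrum ev.
Qed.

(** * The gap bounds the difference of the projectors *)

Section Gap.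
Variables (F F' : closed_subspace H) (P P' : {linear V -> V}).
Hypotheses (P_proj : orthoprojector real_dot P).
Hypotheses (P'_proj : orthoprojector real_dot P').
Hypothesis PE : forall x, P x = projector dot F x.
Hypothesis P'E : forall x, P' x = projector dot F' x.

Lemma le_gap x : nrm x <= 1 -> nrm (P x - P' x) <= gap dot F F'.
Proof.
move=> x_le1; apply: ub_le_sup; last first.
  by exists (x : H); rewrite ?to_real_norm ?PE ?P'E //= -nrmE -(rmorph1 ofR) ler_of_real.
exists 2 => _ [y /= y_le1 <-]; rewrite to_real_norm -PE -P'E.
have {}y_le1 : nrm y <= 1 by rewrite -(ler_of_real k) nrmE rmorph1.
apply: le_trans (ler_nrmD bI _ _) _; rewrite (nrmN bI).
have := nrm_proj bI y P_proj; have := nrm_proj bI y P'_proj; lra.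
Qed.

Lemma gap_ge0 : 0 <= gap dot F F'.
Proof. by apply: le_trans (nrm_ge0 _ _) (le_gap (x := 0) _); rewrite (nrm0 bI) ler01. Qed.

Lemma nrm_projB_le x : nrm (P x - P' x) <= gap dot F F' * nrm x.
Proof.
have [->|x0] := eqVneq x 0; first by rewrite !linear0 addr0 (nrm0 bI) mulr0.
have xp := nrm_gt0 bI x0; rewrite -ler_pdivrMr // mulrC.
rewrite -[X in X * _]gtr0_norm ?invr_gt0 // -(nrmZ bI) scalerBr -!linearZ /=.
by apply: le_gap; rewrite (nrmZ bI) gtr0_norm ?invr_gt0 // mulVf // gt_eqF.
Qed.

End Gap.
End HilbertSpace.

(** * The Hausdorff distance *)

Section Hausdorff.
Variable R : realType.
Implicit Types (S : set R) (u v d : R).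

Lemma dist_to_set_le u v S d : S v -> `|u - v| <= d -> dist_to_set u S <= d.
Proof.
move=> Sv; apply: le_trans; apply: ge_inf; last by exists v.
by exists 0 => _ [w _ <-]; exact: normr_ge0.
Qed.

Lemma hausdorff_dist_le S S' d : 0 <= d ->
    (forall u, S u -> dist_to_set u S' <= d) ->
    (forall u, S' u -> dist_to_set u S <= d) ->
  hausdorff_dist S S' <= d.
Proof.
move=> d_ge0 SS' S'S.
have sup_le (A B : set R) : (forall u, A u -> dist_to_set u B <= d) ->
    sup [set dist_to_set u B | u in A] <= d.
  move=> AB; have [->|/set0P[u Au]] := eqVneq A set0; first by rewrite image_set0 sup0.
  by apply: ge_sup => [|_ [v Av <-]]; [exists (dist_to_set u B), u|exact: AB].
by rewrite ge_max !sup_le.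
Qed.

End Hausdorff.

Theorem theorem4p2 (R : realType) (k : scalar_kind)
    (H : completeNormedModType (scalar_field R k)) (dot : {dot H for scalar_conj R k})
    (dot_norm : forall x : H, dot x x = `|x| ^+ 2)
    (F F' G : closed_subspace H)
    (F_nontrivial : nontrivial F) (F'_nontrivial : nontrivial F')
    (G_nontrivial : nontrivial G) :
  hausdorff_dist [set cos t ^+ 2 | t in angles dot F G]
                 [set cos t ^+ 2 | t in angles dot F' G]
    <= gap dot F F'.
Proof.
have [P HP PE] := real_projector dot_norm F.
have [P' HP' P'E] := real_projector dot_norm F'.
have [Q HQ QE] := real_projector dot_norm G.
have bI := inner_product_real_dot dot_norm.
rewrite (cos_sqr_angles dot_norm HP HQ PE QE) (cos_sqr_angles dot_norm HP' HQ P'E QE).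
have d_ge0 := gap_ge0 dot_norm HP HP' PE P'E.
have PP' := nrm_projB_le dot_norm HP HP' PE P'E; set d := gap dot F F' in d_ge0 PP' *.
have close (A B : {linear realified H -> realified H}) l :
    orthoprojector (real_dot dot) A -> orthoprojector (real_dot dot) B ->
    (forall x, nrm (real_dot dot) (A x - B x) <= d * nrm (real_dot dot) x) ->
  angle_value (real_dot dot) A Q l ->
  dist_to_set l [set l' | angle_value (real_dot dot) B Q l'] <= d.
  move=> HA HB AB ev; set S := [set _ | _].
  have [[l' ll' ev']|/andP[l_ge l_le]] := angle_value_dist bI HA HB HQ AB d_ge0 ev.
    exact: dist_to_set_le ev' ll'.
  (* here l lies between 1 - d and d; the distance to the empty set is 0 *)
  have [->|/set0P[l' ev']] := eqVneq S set0.
    by rewrite /dist_to_set image_set0 inf0.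
  apply: (dist_to_set_le ev').
  have /andP[] := angle_value_bounds bI HB HQ ev'.
  by rewrite ler_norml; move=> ? ?; apply/andP; split; lra.
apply: hausdorff_dist_le => // l ev; first exact: close PP' ev.
apply: close HP' HP _ ev => x; rewrite -(nrmN bI) opprB; exact: PP'.
Qed.
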